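(* Let $n\ge 1$, let $\pi$ be a permutation of $\{1,\dots,n\}$ all of whose cycles have length 1 or 2, and let $\rho=(n+1,\,n+2)$ be the transposition of $n+1$ and $n+2$. Let $\pi\circ\rho$ be the permutation of $\{1,\dots,n+2\}$ acting as $\pi$ on $\{1,\dots,n\}$ and as $\rho$ on $\{n+1,n+2\}$. Then the following algorithm, with input $D_n$ and $\mathrm{Fix}(\pi,D_n)$, returns $|\mathrm{Fix}(\pi\circ\rho,D_{n+2})|$: start with $\mathrm{Sum}:=0$; for each $h\in D_n$ put $h':=\pi(h)$, $\mathrm{Down}:=|\{g\in \mathrm{Fix}(\pi,D_n): g\le h\wedge h'\}|$, $\mathrm{Up}:=|\{g\in \mathrm{Fix}(\pi,D_n): g\ge h\vee h'\}|$, and replace $\mathrm{Sum}$ by $\mathrm{Sum}+\mathrm{Down}\cdot\mathrm{Up}$; finally return $\mathrm{Sum}$. Equivalently, $$|\mathrm{Fix}(\pi\circ\rho,D_{n+2})|=\sum_{h\in D_n}\bigl|\{g\in \mathrm{Fix}(\pi,D_n): g\le h\wedge \pi(h)\}\bigr|\cdot\bigl|\{g\in \mathrm{Fix}(\pi,D_n): g\ge h\vee \pi(h)\}\bigr|.$$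
   Context: $B=\{0,1\}$ with $0\le 1$, and $B^n$ is the set of functions $\{1,\dots,n\}\to B$ (equivalently, $n$-bit strings) with the componentwise order. $D_n$ is the set of monotone (order-preserving) functions $B^n\to B$, ordered pointwise: $g\le h$ iff $g(x)\le h(x)$ for all $x\in B^n$. For $g,h\in D_n$, $g\wedge h$ and $g\vee h$ denote the pointwise (bitwise) AND and OR. A permutation $\sigma$ of $\{1,\dots,n\}$ acts on $B^n$ by $\sigma(x)=x\circ\sigma$, and acts on $D_n$ by $\sigma(g)=g\circ\sigma$, i.e. $\sigma(g)(x)=g(\sigma(x))$. $\mathrm{Fix}(\sigma,D_n)=\{g\in D_n:\sigma(g)=g\}$. *)

(* Defs.v *)
From mathcomp Require Import all_boot all_order all_fingroup.

Set Implicit Arguments.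
Unset Strict Implicit.
Unset Printing Implicit Defensive.

Import Order.TTheory.

(* {1, ..., n} is represented by 'I_n = {0, ..., n - 1}. *)
Notation bits n := {ffun 'I_n -> bool}.
Notation boolfun n := {ffun bits n -> bool}.

(* Used both for the componentwise order on bit strings and for the pointwise
   order on Boolean functions. *)
Definition lepw (T : finType) (f g : {ffun T -> bool}) : bool :=
  [forall x, (f x <= g x)%O].

Definition andpw (T : finType) (f g : {ffun T -> bool}) : {ffun T -> bool} :=
  [ffun x => f x && g x].

Definition orpw (T : finType) (f g : {ffun T -> bool}) : {ffun T -> bool} :=
  [ffun x => f x || g x].

Definition monotone n (f : boolfun n) : bool :=
  [forall x, forall y, lepw x y ==> (f x <= f y)%O].

Definition D n : {set boolfun n} := [set f | monotone f].

(* Not declared as an {action}: since (s * t) i = t (s i) for permutations,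
   x \o (s * t) = (x \o t) \o s, so this is not a right action of 'S_n. *)
Definition permbits n (s : 'S_n) (x : bits n) : bits n :=
  [ffun i => x (s i)].

Definition permfun n (s : 'S_n) (g : boolfun n) : boolfun n :=
  [ffun x => g (permbits s x)].

Definition Fix n (s : 'S_n) (A : {set boolfun n}) : {set boolfun n} :=
  [set g in A | permfun s g == g].

Definition extend2_fun n (s : 'S_n) (i : 'I_(n + 2)) : 'I_(n + 2) :=
  match split i with
  | inl j => lshift 2 (s j)
  | inr k => rshift n k
  end.

Lemma extend2_fun_inj n (s : 'S_n) : injective (extend2_fun s).
Proof.
apply: (can_inj (g := extend2_fun s^-1)) => i; rewrite /extend2_fun.
case: (splitP i) => [j|k] Ei.
  rewrite (unsplitK (inl (s j))) permK; exact: val_inj.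
rewrite (unsplitK (inr k)); exact: val_inj.
Qed.

Definition extend2 n (s : 'S_n) : 'S_(n + 2) := perm (@extend2_fun_inj n s).

Definition rho n : 'S_(n + 2) :=
  tperm (rshift n (ord0 : 'I_2)) (rshift n (ord_max : 'I_2)).

(* The product of permutations applies its left factor first. *)
Definition comp_rho n (s : 'S_n) : 'S_(n + 2) := (rho n * extend2 s)%g.

Lemma comp_rho_lshift n (s : 'S_n) (i : 'I_n) :
  comp_rho s (lshift 2 i) = lshift 2 (s i).
Proof.
rewrite permM tpermD ?eq_rlshift // permE /extend2_fun.
by rewrite (unsplitK (inl i)).
Qed.

Lemma comp_rho_rshift n (s : 'S_n) (k : 'I_2) :
  comp_rho s (rshift n k) = rshift n (rev_ord k).
Proof.
have E (j : 'I_2) : extend2 s (rshift n j) = rshift n j.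
  by rewrite permE /extend2_fun (unsplitK (inr j)).
rewrite permM; case: k => [[|[|//]] lt_k].
  rewrite (_ : Ordinal lt_k = ord0); last exact: val_inj.
  by rewrite tpermL E; congr (rshift n _); apply: val_inj.
rewrite (_ : Ordinal lt_k = ord_max); last exact: val_inj.
by rewrite tpermR E; congr (rshift n _); apply: val_inj.
Qed.

(* The two input sets are passed to the algorithm as lists. *)
Definition fix_count_step n (s : 'S_n) (Fixs : seq (boolfun n))
    (Sum : nat) (h : boolfun n) : nat :=
  let h' := permfun s h in
  let Down := count (fun g => lepw g (andpw h h')) Fixs in
  let Up := count (fun g => lepw (orpw h h') g) Fixs in
  Sum + Down * Up.

Definition fix_count n (s : 'S_n) (Ds Fixs : seq (boolfun n)) : nat :=
  foldl (fix_count_step s Fixs) 0 Ds.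

(* Main.v *)
Require Import Defs.
From mathcomp Require Import all_boot all_order all_fingroup.

(** Fixing the last two bits cuts a Boolean function [F] on [n + 2] bits into
    four slices [F00], [F01], [F10], [F11] on [n] bits.  [F] is monotone iff
    its slices are monotone and increase along the square
    [F00 <= F01, F10 <= F11] ([glue_in_D]).  Permuting the variables by [pi]
    and swapping the last two bits acts on the slices by [pi] and exchanges
    [F01] with [F10], so [F] is invariant iff [F00] and [F11] are fixed by
    [pi], [F01 = pi F10] and [F10 = pi F01] ([permfun_glue]).  Since every
    cycle of [pi] has length 1 or 2, [pi] is an involution and the last two
    equations are equivalent.  An invariant monotone [F] is thus the same thing
    as an arbitrary [h = F10] in [D n] together with two independent choices:
    [F00] fixed by [pi] and below both [h] and [pi h], and [F11] fixed by [pi]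
    and above both ([glue_in_Fix]).  Summing over [h] the number of choices
    ([card_Fix_fiber]) gives the formula, and the algorithm evaluates this sum
    term by term. *)

Set Implicit Arguments.
Unset Strict Implicit.
Unset Printing Implicit Defensive.

(** * Pointwise order and involutions *)

Lemma lepwP (T : finType) (f g : {ffun T -> bool}) :
  reflect (forall x, f x -> g x) (lepw f g).
Proof.
apply: (iffP forallP) => H x; move: (H x); rewrite leEbool.
  by case: (f x) (g x) => [] [].
by case: (f x) (g x) => [] [] // /(_ isT).
Qed.

Lemma lepw_andpw (T : finType) (f g h : {ffun T -> bool}) :
  lepw f (andpw g h) = lepw f g && lepw f h.
Proof.
apply/lepwP/andP => [H | [/lepwP fg /lepwP fh] x fx].
  by split; apply/lepwP => x /H; rewrite ffunE => /andP[].
by rewrite ffunE fg ?fh.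
Qed.

Lemma lepw_orpw (T : finType) (f g h : {ffun T -> bool}) :
  lepw (orpw g h) f = lepw g f && lepw h f.
Proof.
apply/lepwP/andP => [H | [/lepwP gf /lepwP hf] x].
  by split; apply/lepwP => x Hx; apply: H; rewrite ffunE Hx ?orbT.
by rewrite ffunE => /orP[/gf | /hf].
Qed.

Lemma in_DP n (f : boolfun n) :
  reflect (forall x y, lepw x y -> f x -> f y) (f \in D n).
Proof.
rewrite inE; apply: (iffP forallP) => [H x y xy | H x].
  by move/forallP/(_ y)/implyP/(_ xy): (H x); rewrite leEbool; case: (f x) (f y) => [] [].
apply/forallP => y; apply/implyP => /H; rewrite leEbool.
by case: (f x) (f y) => [] [] // /(_ isT).
Qed.

Lemma in_Fix n (s : 'S_n) (A : {set boolfun n}) g :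
  (g \in Fix s A) = (g \in A) && (permfun s g == g).
Proof. exact: in_set. Qed.

Lemma permfun_in_D n (s : 'S_n) (f : boolfun n) : f \in D n -> permfun s f \in D n.
Proof.
move/in_DP => fD; apply/in_DP => x y /lepwP xy; rewrite !ffunE; apply: fD.
by apply/lepwP => i; rewrite !ffunE; apply: xy.
Qed.

Lemma permfun_involutive n (s : 'S_n) : involutive s -> involutive (permfun s).
Proof.
move=> sK f; apply/ffunP => x; rewrite !ffunE; congr (f _).
by apply/ffunP => i; rewrite !ffunE sK.
Qed.

(** A point returns to itself after as many steps as its cycle has elements,
    hence after two steps if this number is 1 or 2. *)
Lemma involutive_porbits (T : finType) (s : {perm T}) :
  (forall C : {set T}, C \in porbits s -> #|C| = 1 \/ #|C| = 2) -> involutive s.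
Proof.
move=> cyc i; have := iter_porbit s i.
by case: (cyc _ (imset_f (porbit s) (isT : i \in T))) => -> //= si; rewrite !si.
Qed.

(** * Appending two bits *)

Section Slices.

Variable n : nat.
Implicit Types (x y : bits n) (f g h k : boolfun n).

Definition append2 x (a b : bool) : bits (n + 2) :=
  [ffun i => match split i with
             | inl j => x j
             | inr j => if j == ord0 then a else b
             end].

Definition init2 (z : bits (n + 2)) : bits n := [ffun i => z (lshift 2 i)].
Definition bit_a (z : bits (n + 2)) : bool := z (rshift n (ord0 : 'I_2)).
Definition bit_b (z : bits (n + 2)) : bool := z (rshift n (ord_max : 'I_2)).

Lemma append2_lshift x a b i : append2 x a b (lshift 2 i) = x i.
Proof. by rewrite ffunE (unsplitK (inl i)). Qed.

Lemma append2_rshift x a b (j : 'I_2) :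
  append2 x a b (rshift n j) = if j == ord0 then a else b.
Proof. by rewrite ffunE (unsplitK (inr j)). Qed.

Lemma init2_append2 x a b : init2 (append2 x a b) = x.
Proof. by apply/ffunP => i; rewrite ffunE append2_lshift. Qed.

Lemma bit_a_append2 x a b : bit_a (append2 x a b) = a.
Proof. exact: append2_rshift. Qed.

Lemma bit_b_append2 x a b : bit_b (append2 x a b) = b.
Proof. exact: append2_rshift. Qed.

Lemma bits2_ext (z t : bits (n + 2)) :
  init2 z = init2 t -> bit_a z = bit_a t -> bit_b z = bit_b t -> z = t.
Proof.
move=> /ffunP Ei Ea Eb; apply/ffunP => i; rewrite -(splitK i).
case: (split i) => [j | [[|[|//]] lt_j]] /=; first by have := Ei j; rewrite !ffunE.
  by rewrite (_ : Ordinal lt_j = ord0) //; apply: val_inj.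
by rewrite (_ : Ordinal lt_j = ord_max) //; apply: val_inj.
Qed.

Lemma append2K z : append2 (init2 z) (bit_a z) (bit_b z) = z.
Proof. by apply: bits2_ext; rewrite ?init2_append2 ?bit_a_append2 ?bit_b_append2. Qed.

Lemma lepw_append2 x y a b c d :
  lepw (append2 x a b) (append2 y c d) = [&& lepw x y, a ==> c & b ==> d].
Proof.
apply/lepwP/and3P => [H | [/lepwP xy /implyP ac /implyP bd] i].
  split; last 2 first.
  - by apply/implyP; have := H (rshift n ord0); rewrite !append2_rshift.
  - by apply/implyP; have := H (rshift n ord_max); rewrite !append2_rshift.
  by apply/lepwP => i; have := H (lshift 2 i); rewrite !append2_lshift.
by rewrite !ffunE; case: (split i) => [j | j]; [apply: xy | case: ifP].
Qed.

(** The product with [rho] exchanges the last two bits; this is why the slices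
    [F01] and [F10] trade places in [permfun_glue]. *)
Lemma permbits_append2 (s : 'S_n) x a b :
  permbits (comp_rho s) (append2 x a b) = append2 (permbits s x) b a.
Proof.
apply: bits2_ext; rewrite ?init2_append2 ?bit_a_append2 ?bit_b_append2.
- by apply/ffunP => i; rewrite !ffunE comp_rho_lshift (unsplitK (inl (s i))).
- by rewrite /bit_a ffunE comp_rho_rshift append2_rshift.
by rewrite /bit_b ffunE comp_rho_rshift append2_rshift.
Qed.

(** * Cutting a function into slices *)

Definition slice (F : boolfun (n + 2)) (a b : bool) : boolfun n :=
  [ffun x => F (append2 x a b)].

(** The Boolean function with slices [F00 = g], [F01 = f], [F10 = h] and
    [F11 = k]. *)
Definition glue g f h k : boolfun (n + 2) :=
  [ffun z => (if bit_a z then (if bit_b z then k else h)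
              else if bit_b z then f else g) (init2 z)].

Lemma glue_append2 g f h k x a b :
  glue g f h k (append2 x a b) =
    (if a then (if b then k else h) else if b then f else g) x.
Proof. by rewrite ffunE bit_a_append2 bit_b_append2 init2_append2. Qed.

Lemma slice_glue g f h k a b :
  slice (glue g f h k) a b =
    if a then (if b then k else h) else if b then f else g.
Proof. by apply/ffunP => x; rewrite ffunE glue_append2. Qed.

Lemma glue_slice F :
  glue (slice F false false) (slice F false true)
       (slice F true false) (slice F true true) = F.
Proof.
apply/ffunP => z; rewrite -(append2K z) glue_append2.
by case: (bit_a z) (bit_b z) => [] []; rewrite ffunE.
Qed.

Lemma eq_glue g f h k g' f' h' k' :
  (glue g f h k == glue g' f' h' k') = [&& g == g', f == f', h == h' & k == k'].
Proof.
apply/eqP/and4P => [E | [/eqP-> /eqP-> /eqP-> /eqP->] //].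
have eq_slice a b := congr1 (fun F => slice F a b) E.
move: (eq_slice false false) (eq_slice false true) (eq_slice true false).
by move: (eq_slice true true); rewrite !slice_glue => -> -> -> ->.
Qed.

Lemma permfun_glue (s : 'S_n) g f h k :
  permfun (comp_rho s) (glue g f h k) =
    glue (permfun s g) (permfun s h) (permfun s f) (permfun s k).
Proof.
apply/ffunP => z; rewrite -(append2K z) ffunE permbits_append2 !glue_append2.
by case: (bit_a z) (bit_b z) => [] []; rewrite ffunE.
Qed.

(** The order on [n + 2] bits is generated by comparisons inside one slice
    (monotone slices) and by raising one of the last two bits (the four edges
    of the square). *)
Lemma glue_in_D g f h k :
  (glue g f h k \in D (n + 2)) =
    [&& g \in D n, f \in D n, h \in D n & k \in D n] &&
    [&& lepw g f, lepw g h, lepw f k & lepw h k].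
Proof.
apply/in_DP/andP => [mono | [/and4P[gD fD hD kD] /and4P[]]].
  (* One case of monotonicity for each pair of corners a b, c d of the square. *)
  have step x y a b c d : lepw x y -> (a ==> c) && (b ==> d) ->
      (if a then (if b then k else h) else if b then f else g) x ->
      (if c then (if d then k else h) else if d then f else g) y.
    move=> xy abcd; rewrite -!glue_append2; apply: mono.
    by rewrite lepw_append2 xy.
  have refl x : lepw x x by apply/lepwP.
  split; apply/and4P; split; (apply/in_DP => x y xy || apply/lepwP => x).
  - exact: (step x y false false false false).
  - exact: (step x y false true false true).
  - exact: (step x y true false true false).
  - exact: (step x y true true true true).
  - exact: (step x x false false false true).
  - exact: (step x x false false true false).
  - exact: (step x x false true true true).
  exact: (step x x true false true true).
move=> /lepwP gf /lepwP gh /lepwP fk /lepwP hk z t.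
rewrite -(append2K z) -(append2K t) lepw_append2 !glue_append2.
case/and3P => zt.
move/in_DP/(_ _ _ zt): gD => gD; move/in_DP/(_ _ _ zt): fD => fD.
move/in_DP/(_ _ _ zt): hD => hD; move/in_DP/(_ _ _ zt): kD => kD.
by case: (bit_a z) (bit_b z) (bit_a t) (bit_b t) => [] [] [] [] // _ _; auto.
Qed.

(** * Invariant functions *)

Variable pi : 'S_n.
Hypothesis piK : involutive pi.

(** Once [f = pi h], the equation [h = pi f] follows from involutivity, and the
    four edges of the square say that [g] is below both [h] and [pi h] and that
    [k] is above both. *)
Lemma glue_in_Fix g f h k :
  (glue g f h k \in Fix (comp_rho pi) (D (n + 2))) =
    [&& f == permfun pi h, h \in D n,
        (g \in Fix pi (D n)) && lepw g (andpw h (permfun pi h)) &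
        (k \in Fix pi (D n)) && lepw (orpw h (permfun pi h)) k].
Proof.
rewrite !in_Fix glue_in_D permfun_glue eq_glue [permfun pi h == f]eq_sym.
have [-> /= | _] := eqVneq f (permfun pi h); last by rewrite /= !andbF.
rewrite permfun_involutive // eqxx lepw_andpw lepw_orpw.
have [hD | hD] := boolP (h \in D n); last by rewrite /= !andbF.
rewrite (permfun_in_D pi hD) /=.
case: (g \in D n) (k \in D n) => [] []; rewrite /= ?andbF //.
case: (permfun pi g == g) (permfun pi k == k) => [] []; rewrite /= ?andbF ?andbT //.
by case: (lepw g h) (lepw g _) => [] []; rewrite /= ?andbF // andbC.
Qed.

(** The fibre of [F |-> F10] over [h] is in bijection with the pairs
    [(F00, F11)], which range over a product. *)
Lemma card_Fix_fiber h : h \in D n ->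
  #|[set F in Fix (comp_rho pi) (D (n + 2)) | slice F true false == h]| =
    #|[set g in Fix pi (D n) | lepw g (andpw h (permfun pi h))]| *
    #|[set k in Fix pi (D n) | lepw (orpw h (permfun pi h)) k]|.
Proof.
move=> hD; rewrite -cardsX.
pose extend gk := glue gk.1 (permfun pi h) h gk.2.
have extend_inj : injective extend.
  by case=> g k [g' k'] /eqP; rewrite eq_glue => /and4P[/eqP/= -> _ _ /eqP/= ->].
rewrite -(card_imset _ extend_inj); apply: eq_card => F.
rewrite in_set; apply/andP/imsetP => [[Ffix /eqP Fh] | [[g k]]].
  move: Ffix; rewrite -{1}(glue_slice F) Fh glue_in_Fix => /and4P[/eqP F01 _ F00 F11].
  exists (slice F false false, slice F true true).
    by apply/setXP; split; rewrite in_set.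
  by rewrite -{1}(glue_slice F) Fh F01.
case/setXP; rewrite in_set => gP; rewrite in_set => kP ->.
by rewrite slice_glue eqxx glue_in_Fix eqxx hD gP kP.
Qed.

Lemma card_Fix_comp_rho :
  #|Fix (comp_rho pi) (D (n + 2))| =
    \sum_(h in D n)
      #|[set g in Fix pi (D n) | lepw g (andpw h (permfun pi h))]| *
      #|[set k in Fix pi (D n) | lepw (orpw h (permfun pi h)) k]|.
Proof.
rewrite -sum1_card (partition_big (fun F => slice F true false) (mem (D n))) /=.
  apply: eq_bigr => h hD; rewrite -card_Fix_fiber // -sum1_card.
  by apply: eq_bigl => F; rewrite in_set.
by move=> F; rewrite -{1}(glue_slice F) glue_in_Fix => /and4P[].
Qed.

End Slices.

(** * The algorithm *)

Lemma count_uniq_card (T : finType) (s : seq T) (A : {set T}) (P : pred T) :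
  uniq s -> s =i A -> count P s = #|[set x in A | P x]|.
Proof.
move=> s_uniq sA; rewrite -size_filter -(card_uniqP (filter_uniq P s_uniq)).
by apply: eq_card => x; rewrite mem_filter in_set sA andbC.
Qed.

Lemma fix_countE n (s : 'S_n) (Ds Fixs : seq (boolfun n)) (A B : {set boolfun n}) :
  uniq Ds -> Ds =i A -> uniq Fixs -> Fixs =i B ->
  fix_count s Ds Fixs =
    \sum_(h in A) #|[set g in B | lepw g (andpw h (permfun s h))]| *
                  #|[set g in B | lepw (orpw h (permfun s h)) g]|.
Proof.
move=> Ds_uniq DsA Fixs_uniq FixsB; rewrite -(eq_bigl _ _ DsA) -big_uniq //=.
pose summand h :=
  #|[set g in B | lepw g (andpw h (permfun s h))]| *
  #|[set g in B | lepw (orpw h (permfun s h)) g]|.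
(* Generalizing the initial value of the accumulator makes the induction go through. *)
suff acc m : foldl (fix_count_step s Fixs) m Ds = m + \sum_(h <- Ds) summand h.
  exact: acc.
elim: {Ds_uniq DsA} Ds m => [|h hs IH] m /=; first by rewrite big_nil addn0.
by rewrite IH big_cons addnA /fix_count_step !(count_uniq_card _ Fixs_uniq FixsB).
Qed.

Theorem mainTheorem4 (n : nat) (hn : 1 <= n) (pi : 'S_n)
    (hpi : forall C : {set 'I_n}, C \in porbits pi -> #|C| = 1 \/ #|C| = 2) :
  (forall Ds Fixs : seq (boolfun n),
      uniq Ds -> Ds =i D n ->
      uniq Fixs -> Fixs =i Fix pi (D n) ->
      fix_count pi Ds Fixs = #|Fix (comp_rho pi) (D (n + 2))|) /\
  #|Fix (comp_rho pi) (D (n + 2))| =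
    \sum_(h in D n)
      #|[set g in Fix pi (D n) | lepw g (andpw h (permfun pi h))]| *
      #|[set g in Fix pi (D n) | lepw (orpw h (permfun pi h)) g]|.
Proof.
have cardE := card_Fix_comp_rho (involutive_porbits hpi).
split=> // Ds Fixs Ds_uniq DsD Fixs_uniq FixsF.
by rewrite cardE; apply: fix_countE.
Qed.
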